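(* Let $k,d,q$ be positive integers and let $G$ be a finite simple graph such that (i) the induced subgraph of $G$ on the set of all vertices of degree (in $G$) larger than $k$ is not $q$-solvable; (ii) in the induced subgraph $G'$ of $G$ on the set of all vertices of degree (in $G$) at most $k$, every vertex has at most $d$ other vertices of $G'$ at distance (in $G'$) at most $2$ from it. Then $\mathrm{HG}(G)<e\,d\,q^k$, where $e$ is the base of the natural logarithm.
   Context: Let $G$ be a finite simple graph with vertices $v_1,\ldots,v_n$ and let $[q]=\{1,\ldots,q\}$ be a set of $q$ colors. A coloring is any $x\in[q]^n$, where $x_i$ is the color of $v_i$. A guessing strategy is a choice, for each $i$, of a function $f_i$ with values in $[q]$ depending only on the colors of the neighbors of $v_i$; vertex $v_i$ guesses correctly on $x$ if $f_i(x)=x_i$. $G$ is $q$-solvable if there is a guessing strategy such that for every coloring $x\in[q]^n$ at least one vertex guesses correctly (in particular, the graph with no vertices is not $q$-solvable). For $G$ with at least one vertex, the hat guessing number $\mathrm{HG}(G)$ is the largest positive integer $q$ such that $G$ is $q$-solvable. The distance between two distinct vertices is the length of a shortest path connecting them, and $\infty$ if there is none. *)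

(* Defs.v *)
From mathcomp Require Import all_boot.
From mathcomp Require Import boolp.

Set Implicit Arguments.
Unset Strict Implicit.
Unset Printing Implicit Defensive.

Record sgraph := SGraph {
  vertex :> finType;
  adj : rel vertex;
  adj_sym : symmetric adj;
  adj_irrefl : irreflexive adj }.

Section Graph.
Variable G : sgraph.
Implicit Types (x y : G) (S : {set G}).

Definition degree x : nat := #|[set y | adj x y]|.

Definition induced S : sgraph :=
  @SGraph {x : G | x \in S} (fun u v => adj (val u) (val v))
    (fun u v => adj_sym (val u) (val v)) (fun u => adj_irrefl (val u)).

Definition path_of_length x y (m : nat) : bool :=
  [exists p : m.-tuple G, [&& path (@adj G) x p, last x p == y & uniq (x :: p)]].

(* [None] stands for infinite distance. *)
Definition distance x y : option nat :=
  match pselect (exists m, path_of_length x y m) with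
  | left ex_path => Some (ex_minn ex_path)
  | right _ => None
  end.

Definition distance_le x y (m : nat) : bool :=
  if distance x y is Some l then l <= m else false.

Definition coloring (q : nat) := {ffun G -> 'I_q}.

Definition strategy (q : nat) (f : G -> coloring q -> 'I_q) : Prop :=
  forall v (x y : coloring q),
    (forall w, adj v w -> x w = y w) -> f v x = f v y.

Definition solvable (q : nat) : Prop :=
  exists f : G -> coloring q -> 'I_q,
    strategy f /\ forall x : coloring q, exists v, f v x = x v.

Definition pos_solvable (q : nat) : bool := (0 < q) && `[< solvable q >].

Lemma ex_pos_solvable : 0 < #|G| -> exists q, pos_solvable q.
Proof.
case/card_gt0P=> v _; exists 1; apply/andP; split=> //; apply/asboolP.
by exists (fun _ _ => ord0); split=> // x; exists v; rewrite [RHS]ord1.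
Qed.

(* Each vertex is right on a fraction 1 / q of the colorings, so that the
   numbers q for which G is q-solvable are bounded. *)
Lemma pos_solvable_leq (q : nat) : pos_solvable q -> q <= #|G|.
Proof.
case/andP=> q_gt0 /asboolP[f [f_local f_solves]].
pose A v : {set coloring q} := [set x | f v x == x v].
pose upd v (z : coloring q) c : coloring q :=
  [ffun w => if w == v then c else z w].
have f_upd v z c : f v (upd v z c) = f v z.
  apply: f_local => w vw; rewrite ffunE; case: eqP => // wv.
  by rewrite wv adj_irrefl in vw.
have cardA v : #|A v| * q <= #|{: coloring q}|.
  have -> : #|A v| * q = #|setX (A v) [set: 'I_q]|.
    by rewrite cardsX cardsT card_ord.
  have inj : {in setX (A v) [set: 'I_q] &,
      injective (fun t : coloring q * 'I_q => upd v t.1 t.2)}.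
    move=> [x c] [y c'] /setXP[/=]; rewrite inE => /eqP fx _.
    move=> /setXP[/=]; rewrite inE => /eqP fy _ exy.
    have ec : c = c' by have := congr1 (fun z : coloring q => z v) exy;
      rewrite /= !ffunE eqxx.
    congr (_, _) => //; apply/ffunP => w; case: (eqVneq w v) => [->|wv].
      by rewrite -fx -fy -(f_upd v x c) -(f_upd v y c') exy.
    by have := congr1 (fun z : coloring q => z w) exy;
      rewrite /= !ffunE (negbTE wv).
  by rewrite -(card_in_imset inj) max_card.
have N_gt0 : 0 < #|{: coloring q}| by rewrite card_ffun card_ord expn_gt0 q_gt0.
have covA : #|{: coloring q}| <= \sum_v #|A v|.
  have -> : #|{: coloring q}| = #|\bigcup_v A v|.
    rewrite -cardsT; apply: eq_card => x; rewrite inE; apply/esym/bigcupP.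
    by have [v fx] := f_solves x; exists v => //; rewrite inE; apply/eqP.
  apply: (big_ind2 (fun (B : {set coloring q}) m => #|B| <= m)) => //.
    by rewrite cards0.
  move=> B m C n Bm Cn; apply: leq_trans (leq_add Bm Cn).
  by rewrite cardsU leq_subr.
rewrite -(leq_pmul2r N_gt0) mulnC.
apply: leq_trans (leq_mul covA (leqnn q)) _.
by rewrite big_distrl /= -sum_nat_const leq_sum.
Qed.

Definition HG (G_gt0 : 0 < #|G|) : nat :=
  ex_maxn (ex_pos_solvable G_gt0) pos_solvable_leq.

End Graph.

(* Main.v *)
Require Import Defs.
From mathcomp Require Import all_boot all_order all_algebra.
From mathcomp Require Import reals sequences.
From mathcomp Require Import boolp exp ring.
Import Order.TTheory GRing.Theory Num.Theory.
Local Open Scope ring_scope.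

Set Implicit Arguments.
Unset Strict Implicit.
Unset Printing Implicit Defensive.

(** Suppose G is N-solvable by a strategy f, with N >= e d q^k; then q <= N,
    and the q colors may be identified with the first q of the N colors. Call a
    vertex high if its degree exceeds k, and low otherwise. The aim is to
    color the low vertices with N colors so that no low vertex ever guesses
    right, whichever of the first q colors the high vertices carry. Under such
    a coloring every guaranteed right guess is made by a high vertex, so f,
    with its guesses outside the first q colors changed arbitrarily, solves
    the induced graph on the high vertices with q colors ([high_solvable]),
    which is excluded.

    Color the low vertices uniformly at random, and let E_v be the event that
    some coloring of the high vertices with q colors makes the low vertex v
    guess right. When the colors of the low neighbors of v are given, v makes
    at most q^k different guesses, since it has at most k neighbors
    ([card_guesses]), and these guesses do not depend on its own color. If u
    is low, distinct from v and not adjacent to v, then E_u does not depend on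
    the color of v. Resampling the color of v therefore shows that,
    conditionally on avoiding any family of such E_u, the event E_v has
    probability at most p = q^k / N <= 1 / (e d) ([low_right_rare]).

    So the lopsided local lemma applies, with the adjacency of low vertices as
    dependency graph; its degrees are at most d. Its usual form would require
    e p (d + 1) <= 1. Shearer's improvement ([local_lemma]) makes e p d <= 1
    sufficient: it uses that, when the events are revealed one at a time, a
    neighbor of the current event is always missing from the conditioning
    family, so that only d - 1 neighbors matter except in the last step.
    Probabilities are replaced by cardinalities throughout. *)

(** * A local lemma of Shearer type *)

Section LocalLemma.
Context {T V : finType}.
Variable A : V -> {set T}.
Implicit Types (S : {set V}) (u v : V).

Definition avoid S : {set T} := [set z | [forall u in S, z \notin A u]].

Lemma avoidP S z : reflect (forall u, u \in S -> z \notin A u) (z \in avoid S).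
Proof. by rewrite inE; apply: (iffP forall_inP). Qed.

Lemma avoid_subset S1 S2 : S1 \subset S2 -> avoid S2 \subset avoid S1.
Proof.
move=> /subsetP S12; apply/subsetP => z /avoidP z2.
by apply/avoidP => u /S12 /z2.
Qed.

Lemma card_avoid_split v S :
  #|avoid S| = (#|A v :&: avoid S| + #|avoid (v |: S)|)%N.
Proof.
rewrite -(cardsID (A v) (avoid S)) setIC; congr (_ + #|pred_of_set _|)%N.
apply/setP => z; rewrite in_setD; apply/andP/avoidP => [[zv /avoidP zS] u|zU].
  by rewrite !inE => /orP[/eqP->|/zS].
split; first by rewrite zU ?setU11.
by apply/avoidP => u uS; rewrite zU ?setU1r.
Qed.

Section Bounds.
Context {R : realFieldType}.
Variables (nb : rel V) (d : nat) (p x : R).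
Hypothesis nb_sym : symmetric nb.
Hypothesis nb_deg : forall v, (#|[set u | nb v u]| <= d)%N.
Hypothesis x_ge0 : 0 <= x.
Hypothesis x_lt1 : x < 1.
(* Lopsided form of independence: only an upper bound on the conditional
   probability of A v is assumed. *)
Hypothesis p_local : forall v S,
  (forall u, u \in S -> u != v /\ ~~ nb v u) ->
  #|A v :&: avoid S|%:R <= p * #|avoid S|%:R.

(** The chain rule: the elements of S1 are added to the conditioning family one
    at a time, and each costs a factor 1 - x. *)
Lemma avoid_extend S1 S2 :
  [disjoint S1 & S2] ->
  (forall u S, u \in S1 -> S \subset (S1 :|: S2) :\ u ->
     #|A u :&: avoid S|%:R <= x * #|avoid S|%:R) ->
  (1 - x) ^+ #|S1| * #|avoid S2|%:R <= #|avoid (S1 :|: S2)|%:R.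
Proof.
have [n] := ubnP #|S1|; elim: n S1 => // n IHn S1 ltS1n dis rare.
have [->|[u uS1]] := set_0Vmem S1; first by rewrite cards0 set0U mul1r.
pose S3 := S1 :\ u.
have sub31 : S3 \subset S1 by apply: subD1set.
have uS2 : u \notin S2 by rewrite (disjointFr dis).
have S1E : S1 :|: S2 = u |: (S3 :|: S2) by rewrite setUA setD1K.
have cardS1 : #|S1| = #|S3|.+1 by rewrite (cardsD1 u) uS1.
have IH : (1 - x) ^+ #|S3| * #|avoid S2|%:R <= #|avoid (S3 :|: S2)|%:R.
  apply: IHn; first by rewrite -ltnS -cardS1.
    exact: disjointWl sub31 dis.
  move=> w S wS3 subS; apply: rare; first exact: (subsetP sub31).
  by apply: subset_trans subS _; rewrite setSD ?setSU.
have := rare u (S3 :|: S2) uS1.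
rewrite S1E setU1K ?subxx; last by rewrite !inE eqxx (negbTE uS2).
move=> /(_ isT) rare_u; have := card_avoid_split u (S3 :|: S2).
move=> /(congr1 (fun m => m%:R : R)); rewrite natrD => cardE.
rewrite cardS1 exprS -mulrA.
apply: le_trans (ler_wpM2l _ IH) _; first by rewrite subr_ge0 ltW.
by rewrite mulrBl mul1r lerBlDr {1}cardE [X in _ <= X]addrC lerD2r.
Qed.

(** Only those conditioning families matter that miss v, a neighbor of the
    vertex u in question; this is the source of the improvement from d to
    d - 1 neighbors. *)
Lemma avoid_neighbors v S :
  v \notin S ->
  (forall u S', u \in S -> S' \subset S :\ u -> nb u v ->
     #|A u :&: avoid S'|%:R <= x * #|avoid S'|%:R) ->
  (1 - x) ^+ #|[set u in S | nb v u]| * #|avoid [set u in S | ~~ nb v u]|%:R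
    <= #|avoid S|%:R.
Proof.
move=> vS rare.
have SE : [set u in S | nb v u] :|: [set u in S | ~~ nb v u] = S.
  by apply/setP => u; rewrite !inE -andb_orr orbN andbT.
rewrite -[X in _ <= #|avoid X|%:R]SE; apply: avoid_extend.
  rewrite -setI_eq0; apply/eqP/setP => u; rewrite !inE.
  by case: (nb v u); rewrite !(andbF, andbT).
move=> u S'; rewrite SE inE nb_sym => /andP[uS uv] subS.
exact: rare.
Qed.

Lemma rare_nonneighbors v S :
  v \notin S ->
  #|A v :&: avoid S|%:R <= p * #|avoid [set u in S | ~~ nb v u]|%:R.
Proof.
move=> vS; set S2 := [set u in S | _].
have sub2 : S2 \subset S by apply/subsetP => u; rewrite inE => /andP[].
apply: (@le_trans _ _ #|A v :&: avoid S2|%:R).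
  by rewrite ler_nat subset_leq_card // setIS ?avoid_subset.
apply: p_local => u; rewrite inE => /andP[uS ->]; split=> //.
by apply: contraNneq vS => <-.
Qed.

Lemma card_neighbors_missing u v S :
  nb u v -> v \notin S -> (#|[set w in S | nb u w]| < d)%N.
Proof.
move=> uv vS; apply: leq_trans (nb_deg u); apply: proper_card.
rewrite properE; apply/andP; split.
  by apply/subsetP => w; rewrite !inE => /andP[].
by apply/subsetPn; exists v; rewrite !inE // uv (negbTE vS).
Qed.

Hypothesis p_le : p <= x * (1 - x) ^+ d.-1.
Hypothesis p_lt : p < (1 - x) ^+ d.

(** If S contains at most d - 1 neighbors of v, the numerator of P(A v | avoid S)
    is at most p P(avoid S2), where S2 are the nonneighbors in S, and the
    denominator at least (1 - x)^(d - 1) P(avoid S2) by induction. The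
    induction hypothesis applies to a neighbor u of v because its conditioning
    families miss v. *)
Lemma rare_missing_neighbor v S :
  v \notin S -> (#|[set u in S | nb v u]| < d)%N ->
  #|A v :&: avoid S|%:R <= x * #|avoid S|%:R.
Proof.
have [n] := ubnP #|S|; elim: n v S => // n IHn v S ltSn vS degv.
apply: le_trans (rare_nonneighbors vS) _.
set a := #|avoid [set u in S | _]|%:R.
have sub_x : 0 <= 1 - x <= 1 by rewrite subr_ge0 ltW //= gerBl.
have lea : (1 - x) ^+ d.-1 * a <= #|avoid S|%:R.
  apply: le_trans _ (avoid_neighbors vS _).
    rewrite ler_wpM2r ?ler0n // ler_wiXn2l //; try by case/andP: sub_x.
    by rewrite -ltnS (leq_trans degv) // leqSpred.
  move=> u S' uS subS uv; have [subSS uS'] := subsetD1P subS.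
  apply: IHn => //.
    by rewrite -ltnS (leq_trans _ ltSn) // ltnS proper_card // properE subSS;
      apply/subsetPn; exists u.
  by apply: card_neighbors_missing uv _; apply: contra vS => /(subsetP subSS).
apply: le_trans (ler_wpM2r _ p_le) _; first exact: ler0n.
by rewrite -mulrA ler_wpM2l.
Qed.

(** The vertices v are added to S one by one. When v is added, all its
    neighbors may already be in S; the conditional probability of A v is then
    only bounded by p / (1 - x)^d, which may exceed x, but a bound below 1 is
    enough to keep the avoided set nonempty. *)
Theorem local_lemma : (0 < #|T|)%N -> exists z, forall v, z \notin A v.
Proof.
move=> T_gt0; suff : forall S, (0 < #|avoid S|)%N.
  by move=> /(_ setT) /card_gt0P[z /avoidP zA]; exists z => v; apply: zA.
move=> S; have [n] := ubnP #|S|; elim: n S => // n IHn S ltSn.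
have [->|[v vS]] := set_0Vmem S.
  have /card_gt0P[z _] := T_gt0; apply/card_gt0P; exists z.
  by apply/avoidP => u; rewrite inE.
rewrite -(setD1K vS); set S' := S :\ v.
have vS' : v \notin S' by rewrite !inE eqxx.
have S'_gt0 : (0 < #|avoid S'|)%N.
  by apply: IHn; move: ltSn; rewrite (cardsD1 v) vS.
suff : (#|A v :&: avoid S'| < #|avoid S'|)%N.
  by rewrite [X in (_ < X)%N](card_avoid_split v) -[X in (X < _)%N]addn0 ltn_add2l.
rewrite -(ltr_nat R); apply: le_lt_trans (rare_nonneighbors vS') _.
set S2 := [set u in S' | _].
have S2_gt0 : 0 < #|avoid S2|%:R :> R.
  rewrite ltr0n (leq_trans S'_gt0) // subset_leq_card // avoid_subset //.
  by apply/subsetP => u; rewrite inE => /andP[].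
have sub_x : 0 <= 1 - x <= 1 by rewrite subr_ge0 ltW //= gerBl.
apply: lt_le_trans _ (avoid_neighbors vS' _).
  rewrite ltr_pM2r // (lt_le_trans p_lt) // ler_wiXn2l //;
    try by case/andP: sub_x.
  apply: leq_trans (nb_deg v); apply: subset_leq_card.
  by apply/subsetP => w; rewrite !inE => /andP[].
move=> u U uS' subU uv; have [subUS uU] := subsetD1P subU.
apply: rare_missing_neighbor => //.
by apply: card_neighbors_missing uv _; apply: contra vS' => /(subsetP subUS).
Qed.

End Bounds.
End LocalLemma.

(** * Resampling one coordinate *)

Section Resample.
Context {V C : finType}.
Implicit Types (v w : V) (c : C) (z : {ffun V -> C}).

Definition recolor v z c : {ffun V -> C} :=
  [ffun w => if w == v then c else z w].

Lemma recolor_off v z c w : w != v -> recolor v z c w = z w.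
Proof. by rewrite ffunE => /negbTE->. Qed.

Lemma recolorK v z c : recolor v (recolor v z c) (z v) = z.
Proof. by apply/ffunP => w; rewrite !ffunE; case: eqP => [->|]. Qed.

Lemma recolor_on v z c : recolor v z c v = c.
Proof. by rewrite ffunE eqxx. Qed.

(** Given P, a uniform z v hits F z with probability at most m / #|C|, as P and
    F z ignore z v. Counting form: exchanging z v with a fresh color c is an
    involution, and it turns z v \in F z into c \in F z. *)
Lemma card_coordinate_in v (P : {set {ffun V -> C}})
    (F : {ffun V -> C} -> {set C}) m :
  (forall z c, (recolor v z c \in P) = (z \in P)) ->
  (forall z c, F (recolor v z c) = F z) ->
  (forall z, (#|F z| <= m)%N) ->
  (#|[set z : {ffun V -> C} | z v \in F z] :&: P| * #|C| <= m * #|P|)%N.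
Proof.
move=> P_inv F_inv F_le.
pose swap (t : {ffun V -> C} * C) := (recolor v t.1 t.2, t.1 v).
have swapK : cancel swap swap.
  by case=> z c; rewrite /swap /= recolorK recolor_on.
set B := _ :&: P; rewrite -cardsT -cardsX -(card_imset _ (can_inj swapK)).
apply: (@leq_trans #|[set t | (t.1 \in P) && (t.2 \in F t.1)]|).
  apply: subset_leq_card; apply/subsetP => t /imsetP[[z c] /setXP[]].
  rewrite !inE => /andP[zF zP] _ ->{t}.
  by rewrite /= P_inv F_inv zP.
rewrite -sum1_card; under eq_bigl do rewrite inE.
rewrite -(pair_big_dep (mem P) (fun z => mem (F z)) (fun _ _ => 1%N)) /=.
rewrite mulnC -sum_nat_const; apply: leq_sum => z _.
by rewrite sum1_card F_le.
Qed.

End Resample.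

(** * Low vertices that guess wrong *)

Section Hats.
Context {G : sgraph}.
Variables (k q N : nat) (f : G -> coloring G N -> 'I_N).
Hypothesis f_local : strategy f.
Hypothesis q_gt0 : (0 < q)%N.
Hypothesis le_qN : (q <= N)%N.

Let c0 : 'I_q := Ordinal q_gt0.

(** To avoid subgraphs, colorings of the low vertices and of the high vertices
    are both total functions on G; [mix] reads each on its own part. *)
Definition mix (z : coloring G N) (a : {ffun G -> 'I_q}) : coloring G N :=
  [ffun w => if (k < degree w)%N then widen_ord le_qN (a w) else z w].

Definition guesses (v : G) (z : coloring G N) : {set 'I_N} :=
  [set f v (mix z a) | a in [set: {ffun G -> 'I_q}]].

(** The event E_v of the proof idea, empty at the high vertices. *)
Definition low_right (v : G) : {set coloring G N} :=
  if (degree v <= k)%N then [set z : coloring G N | z v \in guesses v z]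
  else set0.

Definition low_adj (v w : G) : bool :=
  [&& (degree v <= k)%N, (degree w <= k)%N & adj v w].

Lemma guesses_local v (z z' : coloring G N) :
  (forall w, adj v w -> (degree w <= k)%N -> z w = z' w) ->
  guesses v z = guesses v z'.
Proof.
move=> zz'; apply: eq_imset => a; apply: f_local => w vw.
by rewrite !ffunE; case: ltnP => // lowv; apply: zz'.
Qed.

Lemma card_guesses v z : (degree v <= k)%N -> (#|guesses v z| <= q ^ k)%N.
Proof.
move=> low_v.
pose D := [set w | adj v w].
have /subset_leq_card/leq_trans-> // : guesses v z \subset
    [set f v (mix z a) | a in pffun_on c0 (mem D) (mem 'I_q)].
  apply/subsetP => _ /imsetP[a _ ->].
  (* only the values of a on the neighbors of v matter *)
  pose b := [ffun w => if w \in D then a w else c0].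
  have -> : f v (mix z a) = f v (mix z b).
    by apply: f_local => w vw; rewrite !ffunE inE vw.
  apply: imset_f; apply/pffun_onP; split=> //.
  apply/subsetP => w; rewrite !inE ffunE inE.
  by case: (adj v w); rewrite ?eqxx.
apply: leq_trans (leq_imset_card _ _) _.
rewrite card_pffun_on card_ord leq_pexp2l //.
Qed.

Lemma low_right_local u v z c :
  u != v -> ~~ low_adj v u ->
  (recolor v z c \in low_right u) = (z \in low_right u).
Proof.
move=> uv nvu; rewrite /low_right; case: ifP => [low_u|_]; last by rewrite !inE.
rewrite !inE recolor_off //; congr (_ \in pred_of_set _).
apply: guesses_local => w uw low_w; rewrite recolor_off //.
by apply: contraNneq nvu => wv; rewrite /low_adj low_u -wv low_w adj_sym.
Qed.

Lemma low_right_rare v (S : {set G}) :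
  (forall u, u \in S -> u != v /\ ~~ low_adj v u) ->
  (#|low_right v :&: avoid low_right S| * N <= q ^ k * #|avoid low_right S|)%N.
Proof.
move=> S_far.
have [low_v|high_v] := leqP (degree v) k; last first.
  by rewrite {1}/low_right [(degree v <= k)%N]leqNgt high_v set0I cards0.
rewrite {1}/low_right low_v -[X in (_ * X <= _)%N](card_ord N).
apply: card_coordinate_in => [z c|z c|z]; last exact: card_guesses.
  rewrite !inE; apply: eq_forallb_in => u uS.
  by have [uv nvu] := S_far u uS; rewrite low_right_local.
apply: guesses_local => w vw _; rewrite recolor_off //.
by apply: contraTneq vw => ->; rewrite adj_irrefl.
Qed.

(** With the low vertices colored by z, none of them is ever right, so each high
    vertex can simulate f: it extends the colors it sees by z and reads the
    guess of f back as one of q colors. *)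
Lemma high_solvable z :
  (forall x : coloring G N, exists v, f v x = x v) ->
  (forall v, z \notin low_right v) ->
  solvable (induced [set v : G | (k < degree v)%N]) q.
Proof.
move=> f_solves z_bad; set H := induced _.
pose extend (y : coloring H q) : {ffun G -> 'I_q} :=
  [ffun w => oapp y c0 (insub w)].
exists (fun u y => insubd c0 (val (f (val u) (mix z (extend y))))); split.
  move=> u y y' yy'; congr (insubd _ (val _)); apply: f_local => w uw.
  rewrite !ffunE; case: ltnP => // high_w; congr widen_ord.
  by case: insubP => //= w' _ w'E; apply: yy'; rewrite /= w'E.
move=> y; have [v fv] := f_solves (mix z (extend y)).
have [low_v|high_v] := leqP (degree v) k.
  case/negP: (z_bad v); rewrite /low_right low_v inE.
  apply/imsetP; exists (extend y); rewrite ?inE // fv ffunE.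
  by rewrite ltnNge low_v.
have vH : v \in [set v : G | (k < degree v)%N] by rewrite inE.
exists (Sub v vH); apply: val_inj.
rewrite /= fv !ffunE high_v /= insubT /=.
by rewrite insubdK //= -topredE /=.
Qed.

End Hats.

Lemma adj_distance_le2 (G : sgraph) (v w : G) : adj v w -> distance_le v w 2.
Proof.
move=> vw; have p1 : path_of_length v w 1.
  apply/existsP; exists [tuple w]; rewrite /= vw eqxx !andbT inE.
  by apply: contraTneq vw => ->; rewrite adj_irrefl.
rewrite /distance_le /distance; case: pselect => [ex|[]]; last by exists 1%N.
by case: ex_minnP => m _ /(_ _ p1) /leq_trans->.
Qed.

Lemma card_low_adj (G : sgraph) (k d : nat) :
  (forall v : induced [set v : G | (degree v <= k)%N],
     (#|[set w : induced [set v : G | (degree v <= k)%N]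
         | (w != v) && distance_le v w 2]| <= d)%N) ->
  forall v : G, (#|[set u | low_adj k v u]| <= d)%N.
Proof.
set L := [set v : G | _] => dist2 v.
have [low_v|high_v] := leqP (degree v) k; last first.
  rewrite (_ : [set u | _] = set0) ?cards0 //; apply/setP => u.
  by rewrite !inE /low_adj leqNgt high_v.
have vL : v \in L by rewrite inE.
pose v' : induced L := Sub v vL.
apply: leq_trans (dist2 v').
apply: leq_trans (leq_imset_card val _).
apply: subset_leq_card; apply/subsetP => w; rewrite inE => /and3P[_ low_w vw].
have wL : w \in L by rewrite inE.
apply/imsetP; exists (Sub w wL : induced L); last by [].
rewrite inE; apply/andP; split.
  by apply: contraTneq vw => /(congr1 val) /= ->; rewrite adj_irrefl.
exact: adj_distance_le2.
Qed.

(** * The bound on the hat guessing number *)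

Lemma expR1_gt (R : realType) (d : nat) :
  (0 < d)%N -> (1 + d%:R^-1) ^+ d < expR 1 :> R.
Proof.
move=> d_gt0; have d0 : d%:R != 0 :> R by rewrite pnatr_eq0 -lt0n.
rewrite -[X in expR X](mulfV d0) expRM_natl ltrXn2r -?lt0n //.
  by rewrite addr_ge0 ?invr_ge0 ?ler0n.
by rewrite expR_gt1Dx ?invr_eq0.
Qed.

Theorem theorem1p6 (R : realType) (k d q : nat) (G : sgraph)
  (k_gt0 : (0 < k)%N) (d_gt0 : (0 < d)%N) (q_gt0 : (0 < q)%N)
  (G_gt0 : (0 < #|G|)%N)
  (G_high : ~ solvable (induced [set v : G | (k < degree v)%N]) q)
  (G_low : forall v : induced [set v : G | (degree v <= k)%N],
     (#|[set w : induced [set v : G | (degree v <= k)%N]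
         | (w != v) && distance_le v w 2]| <= d)%N) :
  (HG G_gt0)%:R < expR 1 * d%:R * q%:R ^+ k :> R.
Proof.
rewrite /HG; case: ex_maxnP => N /andP[N_gt0 /asboolP[f [f_local f_solves]]] _.
rewrite ltNge; apply/negP => N_large; apply: G_high.
have d0 : 0 < d%:R :> R by rewrite ltr0n.
have N0 : 0 < N%:R :> R by rewrite ltr0n.
have qk_ge1 : 1 <= q%:R ^+ k :> R by rewrite exprn_ege1 // ler1n.
have qk0 : 0 < q%:R ^+ k :> R by exact: lt_le_trans qk_ge1.
have e_ge1 : 1 <= expR 1 :> R by rewrite -[X in X <= _]expR0 ler_expR.
have le_qN : (q <= N)%N.
  rewrite -(ler_nat R); apply: le_trans N_large.
  apply: (@le_trans _ _ (q%:R ^+ k)).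
    by rewrite -[X in X <= _]expr1 ler_weXn2l // ler1n.
  by rewrite ler_peMl ?(ltW qk0) // mulr_ege1 // ler1n.
(* The weight 1 / (d + 1) of the local lemma: x (1 - x)^(d-1) = (1 - x)^d / d,
   so both conditions on p follow from p < (1 - x)^d / d; and (1 - x)^d is
   (1 + 1/d)^(-d), which exceeds 1/e. *)
pose x : R := (1 + d%:R)^-1; pose p : R := q%:R ^+ k / N%:R.
have d1 : 0 < 1 + d%:R :> R by rewrite ltr_wpDr ?ler0n.
have xE : 1 - x = d%:R * x by rewrite /x; field; rewrite gt_eqF.
have x0 : 0 < x by rewrite invr_gt0.
have yE : (1 - x) ^+ d = ((1 + d%:R^-1) ^+ d)^-1.
  by rewrite -exprVn xE /x; congr (_ ^+ _); field; rewrite !gt_eqF //= addrC.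
have y_gt : (expR 1)^-1 < (1 - x) ^+ d.
  rewrite yE ltf_pV2 ?expR1_gt // posrE ?expR_gt0 // exprn_gt0 //.
  by rewrite ltr_pwDl // invr_ge0 ler0n.
have p_lt_yd : p < (1 - x) ^+ d / d%:R.
  apply: (@le_lt_trans _ _ ((expR 1)^-1 / d%:R)); last first.
    by rewrite ltr_pM2r ?invr_gt0.
  rewrite /p ler_pdivrMr // -invfM mulrC ler_pdivlMr ?mulr_gt0 ?expR_gt0 //.
  by rewrite mulrC.
have x_lt1 : x < 1 by rewrite invf_lt1 // ltrDl.
have y0 : 0 < (1 - x) ^+ d by rewrite exprn_gt0 // subr_gt0.
have p_le : p <= x * (1 - x) ^+ d.-1.
  apply: le_trans (ltW p_lt_yd) _; rewrite -{1}(prednK d_gt0) exprS.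
  rewrite le_eqVlt; apply/orP; left; apply/eqP.
  by move: (_ ^+ d.-1) => w; rewrite xE; field; rewrite gt_eqF.
have p_lt : p < (1 - x) ^+ d.
  apply: lt_le_trans p_lt_yd _.
  by rewrite ler_pdivrMr // ler_peMr ?ler1n ?(ltW y0).
have [] := @local_lemma _ _ (low_right k f le_qN) R (@low_adj G k) d p x.
all: try by [].
- by move=> u v; rewrite /low_adj adj_sym andbCA.
- exact: card_low_adj G_low.
- exact: ltW.
- move=> v S /(low_right_rare f_local q_gt0 le_qN).
  rewrite -(ler_nat R) !natrM natrX.
  by rewrite /p mulrAC ler_pdivlMr.
- by rewrite card_ffun card_ord expn_gt0 N_gt0.
move=> z; exact: (high_solvable f_local q_gt0 f_solves).
Qed.
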